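(* The metric space $L^2([0,1],\mathbb{H})$ is not a Riemannian manifold, i.e. it is not isometric to any Riemannian manifold endowed with its Riemannian distance.
   Context: A Riemannian manifold is a connected smooth manifold modeled on a real Hilbert space (of finite or infinite dimension) with a smooth Riemannian metric. $\mathbb{H}$ is the hyperbolic plane of constant sectional curvature $-1$ and $o\in\mathbb{H}$ a fixed point. $L^2([0,1],\mathbb{H})$ is the space of (classes up to almost everywhere equality of) measurable maps $x\colon t\mapsto x_t$ from $[0,1]$ (with Lebesgue measure) to $\mathbb{H}$ such that $t\mapsto d(o,x_t)$ is square integrable, endowed with the distance $d(x,y)=\left(\int_{[0,1]}d(x_t,y_t)^2\,\mathrm{d}t\right)^{1/2}$. *)

(* Defs.v *)
From HB Require Import structures.
From mathcomp Require Import all_boot all_order all_algebra.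
From mathcomp Require Import generic_quotient.
From mathcomp Require Import all_classical all_reals all_analysis.

Set Implicit Arguments.
Unset Strict Implicit.
Unset Printing Implicit Defensive.

Import Order.TTheory GRing.Theory Num.Theory.
Import numFieldNormedType.Exports.

Local Open Scope classical_set_scope.
Local Open Scope ring_scope.

(* Continuous linear maps E -> F, normed by the operator norm; they are the
   values of Frechet derivatives in the definition of C^k maps below. *)
Section BoundedLinearMaps.
Context {R : realType} (E F : normedModType R).

Definition bounded_linear : {pred (E -> F)} :=
  [pred f : E -> F | `[< linear f /\ continuous f >]].

Record blin := BLin { blin_fun :> E -> F; blinP : blin_fun \in bounded_linear }.

HB.instance Definition _ := [isSub for blin_fun].
HB.instance Definition _ := [Choice of blin by <:].

Lemma bounded_linear_submod : submod_closed bounded_linear.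
Proof.
split.
  by apply/asboolP; split=> [a u v|x]; [rewrite scaler0 addr0|exact: cst_continuous].
move=> a f g /asboolP[lf cf] /asboolP[lg cg]; apply/asboolP; split.
  move=> b u v; rewrite !fctE lf lg !scalerDr addrACA !scalerA mulrC.
  by congr (_ + _ + _); rewrite mulrC.
by move=> x; apply: cvgD; [apply: cvgZl_tmp; exact: cf|exact: cg].
Qed.

HB.instance Definition _ := GRing.isSubmodClosed.Build R (E -> F)
  bounded_linear bounded_linear_submod.
HB.instance Definition _ := [SubChoice_isSubLmodule of blin by <:].

Definition opnorm (f : blin) : R :=
  sup [set `|f x| | x in [set x : E | `|x| <= 1]].

Lemma blin_linear (f : blin) : linear f.
Proof. by have /asboolP[] := blinP f. Qed.

Lemma blin_continuous (f : blin) : continuous f.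
Proof. by have /asboolP[] := blinP f. Qed.

HB.instance Definition _ (f : blin) :=
  GRing.isLinear.Build R E F _ (blin_fun f) (blin_linear f).

Lemma opnorm_has_sup (f : blin) :
  has_sup [set `|f x| | x in [set x : E | `|x| <= 1]].
Proof.
split; first by exists `|f 0|, 0 => //=; rewrite normr0.
have /linear_boundedP : bounded_near f (nbhs (0 : E)).
  exact/linear_bounded_continuous/blin_continuous.
move=> /pinfty_ex_gt0[r r0 fr]; exists r => _ [x /= x1 <-].
by apply: (le_trans (fr x)); rewrite ler_piMr// ltW.
Qed.

Lemma opnorm_ub (f : blin) x : `|x| <= 1 -> `|f x| <= opnorm f.
Proof.
by move=> x1; apply: sup_upper_bound; [exact: opnorm_has_sup|exists x].
Qed.

Lemma opnorm_le (f : blin) C :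
  (forall x, `|x| <= 1 -> `|f x| <= C) -> opnorm f <= C.
Proof.
move=> fC; apply: ge_sup; first by have [] := opnorm_has_sup f.
by move=> _ [x /= x1 <-]; exact: fC.
Qed.

Let opnormD (f g : blin) : opnorm (f + g) <= opnorm f + opnorm g.
Proof.
apply: opnorm_le => x x1; rewrite (le_trans (ler_normD _ _))//.
by rewrite lerD// opnorm_ub.
Qed.

Let opnormZ (a : R) (f : blin) : opnorm (a *: f) = `|a| * opnorm f.
Proof.
have le b g : opnorm (b *: g) <= `|b| * opnorm g.
  by apply: opnorm_le => x x1; rewrite normrZ ler_wpM2l// opnorm_ub.
apply/eqP; rewrite eq_le le/=.
have [->|a0] := eqVneq a 0.
  rewrite normr0 mul0r (le_trans _ (@opnorm_ub _ 0 _))// normr0//.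
have := le a^-1 (a *: f); rewrite scalerA mulVf// scale1r normfV.
by rewrite ler_pdivlMl// normr_gt0.
Qed.

Let opnorm0 (f : blin) : opnorm f = 0 -> f = 0.
Proof.
move=> f0; apply/val_inj/funext => x /=.
have [->|x0] := eqVneq x 0; first exact: linear0.
have : `|f (`|x|^-1 *: x)| <= 0.
  by rewrite -f0 opnorm_ub// normrZ normfV normr_id mulVf// normr_eq0.
rewrite normr_le0 linearZ/= scaler_eq0 invr_eq0 normr_eq0 (negbTE x0)/=.
by move/eqP.
Qed.

HB.instance Definition _ := @Lmodule_isNormed.Build R blin opnorm
  opnormD opnormZ opnorm0.

End BoundedLinearMaps.

(* Only meaningful for U open. f' is a Frechet derivative of f on U and its
   regularity is measured in the operator norm; its values off U are junk. *)
Fixpoint Ck {R : realType} (k : nat) (E F : normedModType R)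
    (U : set E) (f : E -> F) : Prop :=
  if k is k'.+1 then
    exists f' : E -> blin E F,
      (forall x, U x -> is_diff x f (f' x)) /\ Ck k' U f'
  else forall x, U x -> {for x, continuous f}.

Definition smooth {R : realType} (E F : normedModType R)
  (U : set E) (f : E -> F) := forall k, Ck k U f.

Definition hilbert {R : realType} (E : completeNormedModType R) :=
  exists ip : {dot E for idfun}, forall u : E, `|u| ^+ 2 = ip u u.

Section RiemannianManifolds.
Context {R : realType} (E : completeNormedModType R) (M : topologicalType).

(* Only the values of chart_fun on chart_dom, and of chart_inv on the image of
   chart_dom, are meaningful. *)
Record chart := Chart {
  chart_fun :> M -> E;
  chart_inv : E -> M;
  chart_dom : set M;
  chart_dom_open : open chart_dom;
  chart_img_open : open (chart_fun @` chart_dom);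
  chart_funK : {in chart_dom, cancel chart_fun chart_inv};
  chart_fun_continuous : {within chart_dom, continuous chart_fun};
  chart_inv_continuous : {within chart_fun @` chart_dom, continuous chart_inv}
}.

(* The smooth structure is the one generated by the (not necessarily maximal)
   atlas; chart_at witnesses that the atlas covers M. *)
Record manifold := Manifold {
  atlas : set chart;
  chart_at : M -> chart;
  chart_at_atlas : forall p, atlas (chart_at p);
  chart_at_dom : forall p, chart_dom (chart_at p) p;
  atlas_smooth : forall c c', atlas c -> atlas c' ->
    smooth (c @` (chart_dom c `&` chart_dom c')) (c' \o chart_inv c);
  manifold_hausdorff : hausdorff_space M;
  manifold_connected : connected [set: M]
}.

(* gram c x is the metric at the point of coordinates x, read in the chart c; it
   is a continuous bilinear form on E, identified with an element of
   L(E, L(E, R)). Together with this continuity, gram_pos says that the inner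
   product on each tangent space defines its Hilbert space topology. gram_compat
   is the tensorial change of coordinates. *)
Record riemannian_manifold := RiemannianManifold {
  rmanifold :> manifold;
  gram : chart -> E -> blin E (blin E R^o);
  gram_smooth : forall c, atlas rmanifold c ->
    smooth (c @` chart_dom c) (gram c);
  gram_sym : forall c p, atlas rmanifold c -> chart_dom c p ->
    forall u v, gram c (c p) u v = gram c (c p) v u;
  gram_pos : forall c p, atlas rmanifold c -> chart_dom c p ->
    exists2 k : R, 0 < k & forall u, k * `|u| ^+ 2 <= gram c (c p) u u;
  gram_compat : forall c c' p, atlas rmanifold c -> atlas rmanifold c' ->
    chart_dom c p -> chart_dom c' p ->
    let T := 'd (c' \o chart_inv c) (c p) in
    forall u v, gram c (c p) u v = gram c' (c' p) (T u) (T v)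
}.

Variable X : riemannian_manifold.

Definition C1_at (gamma : R -> M) (t : R) :=
  {for t, continuous gamma} /\
  forall c, atlas X c -> chart_dom c (gamma t) ->
    \forall s \near t, derivable (c \o gamma : R -> E) s 1 /\
                       {for s, continuous (derive1 (c \o gamma : R -> E))}.

(* C^1 on the closed interval, with one-sided derivatives at the end points:
   gamma extends to a curve which is C^1 around each point of [a, b]. *)
Definition C1_on (a b : R) (gamma : R -> M) :=
  exists delta : R -> M,
    forall t, a <= t <= b -> delta t = gamma t /\ C1_at delta t.

Definition piecewise_C1 (gamma : R -> M) :=
  exists2 s : seq R, itv_partition 0 1 s &
    forall i, (i < size s)%N -> C1_on (nth 0 (0 :: s) i) (nth 0 s i) gamma.

(* By gram_compat any other chart around gamma t gives the same value when gamma
   is differentiable at t; the value is junk at the finitely many break points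
   of a piecewise C^1 curve. *)
Definition speed (gamma : R -> M) (t : R) : R :=
  let c := chart_at X (gamma t) in
  let v := derive1 (c \o gamma : R -> E) t in
  Num.sqrt (gram X c (c (gamma t)) v v).

Definition curve_length (gamma : R -> M) : \bar R :=
  (\int[lebesgue_measure]_(t in `[0%R, 1%R]) (speed gamma t)%:E)%E.

Definition riemannian_distance (p q : M) : \bar R :=
  ereal_inf [set curve_length gamma | gamma in
    [set gamma | [/\ piecewise_C1 gamma, gamma 0 = p & gamma 1 = q]]].

End RiemannianManifolds.

Section L2Hyperbolic.
Context {R : realType}.

Definition arcosh (x : R) : R := ln (x + Num.sqrt (x ^+ 2 - 1)).

(* Upper half-plane model: the distance associated with (dx^2 + dy^2) / y^2. *)
Record hplane := HPlane { hpt :> R * R; hpt_gt0 : 0 < hpt.2 }.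

Definition hdist (p q : hplane) : R :=
  arcosh (1 + ((p.1 - q.1) ^+ 2 + (p.2 - q.2) ^+ 2) / (2 * p.2 * q.2)).

Local Notation mu := (@lebesgue_measure R).
Local Notation I := (`[0%R, 1%R]%classic : set (measurableTypeR R)).

(* Maps are total on R but only their restriction to [0, 1] matters, since the
   quotient below identifies maps that agree almost everywhere on [0, 1]. *)
Variable o : hplane.

Record L2fun := L2Fun {
  L2fun_fun :> R -> hplane;
  L2fun_measurable : measurable_fun I
    (hpt \o L2fun_fun : measurableTypeR R -> measurableTypeR R * measurableTypeR R);
  L2fun_integrable :
    mu.-integrable I (fun t => (hdist o (L2fun_fun t) ^+ 2)%:E)
}.

HB.instance Definition _ := gen_eqMixin L2fun.
HB.instance Definition _ := gen_choiceMixin L2fun.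

Definition L2_ae_eq (x y : L2fun) : bool :=
  `[< {ae mu, forall t, I t -> x t = y t} >].

Let L2_ae_eq_refl : reflexive L2_ae_eq.
Proof. by move=> x; apply/asboolP/aeW. Qed.

Let L2_ae_eq_sym : symmetric L2_ae_eq.
Proof.
by move=> x y; apply/idP/idP => /asboolP xy; apply/asboolP;
  apply: filterS xy => t xy It; rewrite xy.
Qed.

Let L2_ae_eq_trans : transitive L2_ae_eq.
Proof.
move=> y x z /asboolP xy /asboolP yz; apply/asboolP.
by apply: filterS2 xy yz => t xy yz It; rewrite xy// yz.
Qed.

Canonical L2_ae_eq_equiv :=
  EquivRel L2_ae_eq L2_ae_eq_refl L2_ae_eq_sym L2_ae_eq_trans.

Definition L2space : Type := {eq_quot L2_ae_eq}%qT.
HB.instance Definition _ := Choice.on L2space.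
HB.instance Definition _ := EqQuotient.on L2space.

Definition L2dist (x y : L2space) : R :=
  Num.sqrt (\int[mu]_(t in I) (hdist (repr x t) (repr y t) ^+ 2)).

End L2Hyperbolic.

(* Main.v *)
(* A small ball of a Riemannian manifold is almost isometric to a ball of an
   inner product space, where any three vectors satisfy
   |a - b|^2 + |b - c|^2 + |c - a|^2 <= 3 (|a|^2 + |b|^2 + |c|^2).
   On the other hand, maps [0, 1] -> H that are constant on [0, s^2] and equal
   to o elsewhere form a copy of H rescaled by s, so that every ball around the
   constant map o contains small copies of arbitrarily large tripods of H. Far
   from its centre, a tripod of H with legs of length d has its ends at mutual
   distances close to 2d, and 12 d^2 > 9 d^2.

   The comparison with the inner product at p only uses the continuity of the
   metric. The upper bound on the distance is the length of a straight line in
   a chart. For the lower bound, a short curve from p cannot leave a ball of the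
   chart: its coordinates would converge at the exit time, by completeness of
   the model space, to a point which is still in the ball. *)

Require Import Defs.
From mathcomp Require Import all_boot all_order all_algebra.
From mathcomp Require Import all_classical all_reals all_analysis.
From mathcomp Require Import generic_quotient measurable_realfun ring lra.

Set Implicit Arguments.
Unset Strict Implicit.
Unset Printing Implicit Defensive.

Import Order.TTheory GRing.Theory Num.Theory.
Import numFieldNormedType.Exports.

Local Open Scope classical_set_scope.
Local Open Scope ring_scope.

(** * Continuous bilinear forms *)

Lemma blin_norm_le (R : realType) (E F : normedModType R) (f : blin E F) x :
  `|f x| <= `|f| * `|x|.
Proof.
have [->|x0] := eqVneq x 0; first by rewrite linear0 !normr0 mulr0.
have nx : 0 < `|x| by rewrite normr_gt0.
rewrite -ler_pdivrMr// mulrC.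
have := @opnorm_ub _ _ _ f (`|x|^-1 *: x).
by rewrite linearZ/= !normrZ normfV normr_id mulVf ?gt_eqF//; apply.
Qed.

Lemma blinB (R : realType) (E F : normedModType R) (f g : blin E F) x :
  (f - g) x = f x - g x.
Proof. by have /(congr1 (@^~ x)) := raddfB val f g. Qed.

Lemma blin_cvg (R : realType) (V W : normedModType R) (T : Type)
    (H : set_system T) (FH : Filter H) (fs : T -> blin V W) (ws : T -> V)
    (f : blin V W) (w : V) :
  fs x @[x --> H] --> f -> ws x @[x --> H] --> w ->
  fs x (ws x) @[x --> H] --> f w.
Proof.
move=> fsf wsw.
have -> : (fun x => fs x (ws x)) = (fun x => (fs x - f) (ws x) + f (ws x)).
  by apply/funext => x /=; rewrite subrK.
rewrite -[f w]add0r; apply: cvgD; last first.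
  exact: (cvg_comp ws f wsw (blin_continuous (f := f) (x:=w))).
apply/norm_cvg0P.
have l0 : `|fs x - f| * `|ws x| @[x --> H] --> (0 : R).
  rewrite -(mul0r `|w|); apply: cvgM; last exact: cvg_norm.
  by apply/norm_cvg0P; apply/subr_cvg0.
apply: (squeeze_cvgr _ (cvg_cst 0) l0).
by near=> x; rewrite normr_ge0 blin_norm_le.
Unshelve. all: by end_near. Qed.

Lemma derive1_blin_comp (R : realType) (E F : normedModType R) (L : blin E F)
    (f : R -> E) t : derivable f t 1 ->
  derivable (L \o f) t 1 /\ derive1 (L \o f) t = L (derive1 f t).
Proof.
move=> /derivable1_diffP df.
have dL : differentiable L (f t).
  exact: linear_differentiable (blin_continuous (f := L)).
have dLf : differentiable (L \o f) t by exact: differentiable_comp.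
split; first exact/derivable1_diffP.
have -> : derive1 (L \o f) t = 'd (L \o f) t 1 := derive1E' dLf.
have -> : derive1 f t = 'd f t 1 := derive1E' df.
have -> : 'd (L \o f) t = 'd L (f t) \o 'd f t :> (R -> F) := diff_comp df dL.
have dE : 'd L (f t) = L :> (E -> F) := diff_lin _ (blin_continuous (f := L)).
exact: (congr1 (fun h : E -> F => h ('d f t 1)) dE).
Qed.

Section InnerProducts.
Context {R : realType} {E : normedModType R}.
Implicit Types (g h : blin E (blin E R^o)) (u v w : E).

Lemma formDl g u v w : g (u + v) w = g u w + g v w.
Proof. by rewrite linearD. Qed.

Lemma formBl g u v w : g (u - v) w = g u w - g v w.
Proof. by rewrite linearB. Qed.

Lemma formZl g a u w : g (a *: u) w = a * g u w.
Proof. by rewrite linearZ. Qed.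

Lemma formDr g u v w : g u (v + w) = g u v + g u w.
Proof. exact: linearD. Qed.

Lemma formBr g u v w : g u (v - w) = g u v - g u w.
Proof. exact: linearB. Qed.

Lemma formZr g a u w : g u (a *: w) = a * g u w.
Proof. exact: linearZ. Qed.

Lemma form_norm_le g u v : `|g u v| <= `|g| * `|u| * `|v|.
Proof.
have guv : `|g u v| <= `|g u| * `|v| := blin_norm_le (g u) v.
apply: (le_trans guv).
by rewrite ler_wpM2r// blin_norm_le.
Qed.

Definition inner_product g := (forall u v, g u v = g v u) /\
  exists2 k : R, 0 < k & forall u, k * `|u| ^+ 2 <= g u u.

Lemma inner_product_ge0 g u : inner_product g -> 0 <= g u u.
Proof.
by move=> [_ [k k0 /(_ u)]]; apply: le_trans; rewrite mulr_ge0 ?exprn_ge0// ltW.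
Qed.

Lemma inner_product_CS g u v : inner_product g ->
  g u v ^+ 2 <= g u u * g v v.
Proof.
move=> ipg; have [sg [k k0 kg]] := ipg.
have [->|v0] := eqVneq v 0; first by rewrite !linear0 expr0n/= mulr0.
have gv : 0 < g v v.
  by apply: lt_le_trans (kg v); rewrite mulr_gt0// exprn_gt0// normr_gt0.
(* Nonnegativity is applied to the component of [u] orthogonal to [v], multiplied by [g v v] to
   avoid a division. *)
have := inner_product_ge0 (g v v *: u - g u v *: v) ipg.
rewrite !formBl !formBr !formZl !formZr (sg v u).
suff -> : g v v * (g v v * g u u) - g v v * (g u v * g u v) -
  (g u v * (g v v * g u v) - g u v * (g u v * g v v)) =
  g v v * (g u u * g v v - g u v ^+ 2).
  by rewrite pmulr_rge0// subr_ge0.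
by ring.
Qed.

(* [3 (|a|^2 + |b|^2 + |c|^2)] minus the left-hand side is [|a + b + c|^2]. *)
Lemma inner_product_tripod g a b c : inner_product g ->
  g (a - b) (a - b) + g (b - c) (b - c) + g (c - a) (c - a) <=
  3 * (g a a + g b b + g c c).
Proof.
move=> ipg; have := inner_product_ge0 (a + b + c) ipg; have [sg _] := ipg.
rewrite !(formBl, formBr, formDl, formDr) (sg b a) (sg c a) (sg c b).
by lra.
Qed.

(** The operator norm gives the absolute error [e * k * |u|^2], which coercivity of [g] turns into
    an error relative to [g u u]. *)
Lemma form_near g h k e u : (forall v, k * `|v| ^+ 2 <= g v v) ->
  `|h - g| <= e * k -> 0 <= e ->
  (1 - e) * g u u <= h u u <= (1 + e) * g u u.
Proof.
move=> kg hg e0.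
have : `|h u u - g u u| <= e * g u u.
  have -> : h u u - g u u = (h - g) u u by rewrite !blinB.
  apply: (le_trans (form_norm_le _ _ _)); rewrite -mulrA -expr2.
  rewrite (@le_trans _ _ (e * k * `|u| ^+ 2))//.
    by rewrite ler_wpM2r// exprn_ge0.
  by rewrite -mulrA ler_wpM2l.
rewrite ler_norml => /andP[? ?]; apply/andP; split; lra.
Qed.

Lemma form_cvg (T : Type) (H : set_system T) (FH : Filter H)
    (gs : T -> blin E (blin E R^o)) us vs g u v :
  gs x @[x --> H] --> g -> us x @[x --> H] --> u -> vs x @[x --> H] --> v ->
  gs x (us x) (vs x) @[x --> H] --> (g u v : R).
Proof. by move=> gsg usu; apply: blin_cvg; exact: blin_cvg. Qed.

Definition formnorm g u : R := Num.sqrt (g u u).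

Lemma formnorm_ge0 g u : 0 <= formnorm g u.
Proof. exact: sqrtr_ge0. Qed.

Lemma sqr_formnorm g u : inner_product g -> formnorm g u ^+ 2 = g u u.
Proof. by move=> ipg; rewrite sqr_sqrtr// inner_product_ge0. Qed.

Lemma ler_form_formnorm g u v : inner_product g ->
  g u v <= formnorm g u * formnorm g v.
Proof.
move=> ipg; rewrite (le_trans (ler_norm _))// -sqrtr_sqr.
by rewrite -sqrtrM ?inner_product_ge0// ler_wsqrtr// inner_product_CS.
Qed.

Lemma ler_formnormD g u v : inner_product g ->
  formnorm g (u + v) <= formnorm g u + formnorm g v.
Proof.
move=> ipg; rewrite -(@ler_pXn2r _ 2%N) ?nnegrE ?addr_ge0 ?formnorm_ge0//.
rewrite sqrrD !sqr_formnorm// formDl !formDr (ipg.1 v u).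
by have := ler_form_formnorm u v ipg; lra.
Qed.

Lemma formnorm0 g : formnorm g 0 = 0.
Proof. by rewrite /formnorm linear0 sqrtr0. Qed.

Lemma formnormZ g a u : formnorm g (a *: u) = `|a| * formnorm g u.
Proof.
rewrite /formnorm formZl formZr mulrA -expr2 sqrtrM ?sqr_ge0//.
by rewrite sqrtr_sqr.
Qed.

Lemma formnorm_ge g k u : 0 <= k -> (forall v, k ^+ 2 * `|v| ^+ 2 <= g v v) ->
  k * `|u| <= formnorm g u.
Proof.
move=> k0 kg; rewrite -[leLHS]ger0_norm ?mulr_ge0// -sqrtr_sqr.
by rewrite ler_wsqrtr// exprMn.
Qed.

Lemma formnorm_cvg (T : Type) (H : set_system T) (FH : Filter H) g us u :
  us x @[x --> H] --> u -> formnorm g (us x) @[x --> H] --> formnorm g u.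
Proof.
move=> usu; apply: (cvg_comp (fun x => g (us x) (us x)) Num.sqrt).
  exact: (@form_cvg _ _ _ (cst g) us us g u u (cvg_cst g) usu usu).
exact: sqrt_continuous.
Qed.

End InnerProducts.

(** * Charts and speed of curves *)

Section Charts.
Context {R : realType} {E : completeNormedModType R} {M : topologicalType}.
Implicit Types c : chart E M.

Lemma chart_invP c x : (c @` chart_dom c) x ->
  chart_dom c (chart_inv c x) /\ c (chart_inv c x) = x.
Proof. by case=> p dp <-; rewrite chart_funK// inE. Qed.

Lemma chart_inv_cvg c x : (c @` chart_dom c) x ->
  chart_inv c y @[y --> x] --> chart_inv c x.
Proof.
move=> cx; have := @chart_inv_continuous _ _ _ c.
rewrite continuous_open_subspace; last exact: chart_img_open.
by apply; rewrite inE.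
Qed.

Lemma chart_cvg c p : chart_dom c p -> c q @[q --> p] --> c p.
Proof.
move=> cp; have := @chart_fun_continuous _ _ _ c.
rewrite continuous_open_subspace; last exact: chart_dom_open.
by apply; rewrite inE.
Qed.

Lemma near_chart_dom c p : chart_dom c p -> \forall q \near p, chart_dom c q.
Proof.
by move=> cp; apply: open_nbhs_nbhs; split => //; exact: chart_dom_open.
Qed.

Lemma near_transition_dom c c' x :
    (c @` (chart_dom c `&` chart_dom c')) x ->
  \forall y \near x, (c @` (chart_dom c `&` chart_dom c')) y.
Proof.
move=> [p [cp c'p] <-].
have cx : (c @` chart_dom c) (c p) by exists p.
have near_c' : \forall y \near c p, chart_dom c' (chart_inv c y).
  apply: (chart_inv_cvg cx); rewrite chart_funK ?inE//.
  exact: near_chart_dom.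
have near_c : \forall y \near c p, (c @` chart_dom c) y.
  by apply: open_nbhs_nbhs; split => //; exact: chart_img_open.
near=> y; have [cy yE] : chart_dom c (chart_inv c y) /\ c (chart_inv c y) = y.
  by apply: chart_invP; near: y.
exists (chart_inv c y) => //; split => //.
by near: y.
Unshelve. all: by end_near. Qed.

Variable X : riemannian_manifold E M.

(** Chain rule for [c' \o g = (c' \o chart_inv c) \o (c \o g)], an identity valid only near [t], as
    long as [g] stays in the domain of [c]. *)
Lemma transition_derive c c' (g : R -> M) t : atlas X c -> atlas X c' ->
  {for t, continuous g} -> chart_dom c (g t) -> chart_dom c' (g t) ->
  derivable (c \o g : R -> E) t 1 ->
  derive1 (c' \o g : R -> E) t =
    'd (c' \o chart_inv c) (c (g t)) (derive1 (c \o g : R -> E) t).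
Proof.
move=> ac ac' gt cg c'g dcg.
have [f' [df' _]] := atlas_smooth ac ac' 1.
have dtr : differentiable (c' \o chart_inv c) (c (g t)).
  by have [] := df' (c (g t)) (ex_intro2 _ _ (g t) (conj cg c'g) erefl).
have dcg' : differentiable (c \o g : R -> E) t by exact/derivable1_diffP.
rewrite derive1E (@near_eq_derive _ _ _ _ ((c' \o chart_inv c) \o (c \o g))).
  rewrite deriveE; last exact: differentiable_comp.
  by rewrite diff_comp//= -derive1E'.
have := gt _ (near_chart_dom cg); rewrite near_simpl /= => ncg.
by near=> s => /=; rewrite chart_funK// inE; near: s.
Unshelve. all: by end_near. Qed.

(** [speed] reads the metric in the chart [chart_at X (g t)], which changes with [t]. Tensoriality
    of the metric allows a single chart to be used along a piece of curve. *)
Lemma speedE c (g : R -> M) t : atlas X c ->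
  {for t, continuous g} -> chart_dom c (g t) ->
  derivable (c \o g : R -> E) t 1 ->
  let v := derive1 (c \o g : R -> E) t in
  speed X g t = Num.sqrt (gram X c (c (g t)) v v).
Proof.
move=> ac gt cg dcg v; rewrite /speed.
have ag := chart_at_atlas X (g t); have dg := chart_at_dom X (g t).
rewrite (gram_compat ac ag cg dg).
by rewrite (transition_derive ac ag).
Qed.

Lemma gram_cvg c p : atlas X c -> chart_dom c p ->
  gram X c y @[y --> c p] --> gram X c (c p).
Proof. by move=> ac cp; have := gram_smooth ac 0; apply; exists p. Qed.

Lemma gram_inner_product c p : atlas X c -> chart_dom c p ->
  inner_product (gram X c (c p)).
Proof. by move=> ac cp; split; [exact: gram_sym|exact: gram_pos]. Qed.

(** [C1_at] asks for continuity of [g] at [t] only. At nearby points it is recovered by writing [g]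
    as [chart_inv c] after the differentiable map [c \o g]. *)
Lemma C1_at_near c (g : R -> M) t : C1_at X g t -> atlas X c ->
    chart_dom c (g t) ->
  \forall s \near t, [/\ {for s, continuous g}, chart_dom c (g s),
    derivable (c \o g : R -> E) s 1 &
    {for s, continuous (derive1 (c \o g : R -> E))}].
Proof.
move=> [gt C1] ac cg.
have near_c : \forall s \near t, chart_dom c (g s) by exact/gt/near_chart_dom.
have near_nearc : \forall s \near t, \forall r \near s, chart_dom c (g r).
  exact/nbhs_interior.
have near_C1 := C1 c ac cg.
near=> s; have [dcg ctg] : derivable (c \o g : R -> E) s 1 /\
    {for s, continuous (derive1 (c \o g : R -> E))} by near: s.
have cgs : chart_dom c (g s) by near: s.
split => //; have near_cs : \forall r \near s, chart_dom c (g r) by near: s.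
have gE : {near s, chart_inv c \o (c \o g) =1 g}.
  by near=> r => /=; rewrite chart_funK// inE; near: r.
apply: cvg_trans; first exact: (near_eq_cvg gE).
rewrite /= -[g s](@chart_funK _ _ _ c) ?inE//.
apply: continuous_cvg; first by apply: chart_inv_cvg; exists (g s).
exact/differentiable_continuous/derivable1_diffP.
Unshelve. all: by end_near. Qed.

Lemma speed_cvg (g : R -> M) t : C1_at X g t ->
  speed X g s @[s --> t] --> speed X g t.
Proof.
move=> C1; set c := chart_at X (g t).
have ac : atlas X c := chart_at_atlas X (g t).
have cg : chart_dom c (g t) := chart_at_dom X (g t).
have near_C1 := C1_at_near C1 ac cg.
have [gt _ dg cdg] := nbhs_singleton near_C1.
rewrite (speedE ac gt cg dg).
pose v s := derive1 (c \o g : R -> E) s.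
have sE : {near t, (fun s => Num.sqrt (gram X c (c (g s)) (v s) (v s)))
    =1 speed X g}.
  near=> s; have [gs cgs dgs _] : [/\ {for s, continuous g}, chart_dom c (g s),
    derivable (c \o g : R -> E) s 1 &
    {for s, continuous (derive1 (c \o g : R -> E))}] by near: s.
  by rewrite (speedE ac).
apply: cvg_trans; first exact: (near_eq_cvg sE).
apply: (continuous_cvg _ (@sqrt_continuous R _)).
apply: form_cvg => //.
apply: (@cvg_comp _ _ _ (fun s => c (g s)) (gram X c)); last exact: gram_cvg.
exact: (cvg_comp g c gt (chart_cvg cg)).
Unshelve. all: by end_near. Qed.

End Charts.

(** * Lower bound on the length of curves *)

Section ChartBall.
Context {R : realType} {E : completeNormedModType R} {M : topologicalType}.
Variables (X : riemannian_manifold E M) (c : chart E M) (ac : atlas X c).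
Variables (x0 : E) (g0 : blin E (blin E R^o)) (ip0 : inner_product g0).
Variables (k : R) (k_gt0 : 0 < k).
Hypothesis g0_ge : forall u, k ^+ 2 * `|u| ^+ 2 <= g0 u u.
Variables (l r : R) (l_gt0 : 0 < l).
Local Notation N := (formnorm g0).
Hypothesis ball_img : forall x, N (x - x0) < r -> (c @` chart_dom c) x.
Hypothesis ball_gram : forall x, N (x - x0) < r ->
  forall v, l ^+ 2 * g0 v v <= gram X c x v v.

(** [g0] will be the metric frozen at the centre [x0], [l] bounds how far the metric may drop below
    it on the ball, and [k] compares [g0] with the norm of [E], for which completeness holds. *)
Definition chart_ball : set M := [set q | chart_dom c q /\ N (c q - x0) < r].

Lemma near_chart_ball q : chart_ball q -> \forall q' \near q, chart_ball q'.
Proof.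
move=> [cq cqr]; near=> q'; split; first by near: q'; exact: near_chart_dom.
near: q'; have : N (c q' - x0) @[q' --> q] --> N (c q - x0).
  by apply: formnorm_cvg; apply: cvgB; [exact: chart_cvg|exact: cvg_cst].
by move/cvgr_lt; apply.
Unshelve. all: by end_near. Qed.

Lemma speed_ge (d : R -> M) t : C1_at X d t -> chart_ball (d t) ->
  l * N (derive1 (c \o d : R -> E) t) <= speed X d t.
Proof.
move=> C1 [cd dr]; have [dt _ dcd _] := nbhs_singleton (C1_at_near C1 ac cd).
rewrite (speedE ac dt cd dcd); set v := derive1 _ _.
have -> : l * N v = Num.sqrt (l ^+ 2 * g0 v v).
  by rewrite sqrtrM ?sqr_ge0// sqrtr_sqr ger0_norm// ltW.
by rewrite ler_wsqrtr// ball_gram.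
Qed.

Section Curve.
Variables (d : R -> M) (S : R -> R) (a b : R).
Hypothesis C1d : forall t, a <= t <= b -> C1_at X d t.
Hypothesis dS : forall t, a < t < b -> is_derive t 1 S (speed X d t).
Hypothesis cS : {within `[a, b], continuous S}.

Lemma primitive_nondecreasing t1 t2 : a <= t1 -> t1 <= t2 -> t2 <= b ->
  S t1 <= S t2.
Proof.
move=> at1 t12 t2b; apply: (@ger0_derive1_ndecr _ _ a b) => //.
- by move=> x; rewrite in_itv => /dS [].
- by move=> x; rewrite in_itv derive1E => /dS [_ ->]; exact: sqrtr_ge0.
Qed.

(** The displacement [u] is tested against the linear form [g0 u], which reduces the claim to a
    monotonicity statement for a real function. Here [S] is a primitive of the speed, that is, arc
    length. *)
Lemma formnorm_le_primitive t1 t2 : a <= t1 -> t1 <= t2 -> t2 <= b ->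
  (forall t, t1 <= t <= t2 -> chart_ball (d t)) ->
  l * N (c (d t2) - c (d t1)) <= S t2 - S t1.
Proof.
move=> at1 t12 t2b db; set u := c (d t2) - c (d t1).
have S12 : S t1 <= S t2 by exact: primitive_nondecreasing.
have [->|u0] := eqVneq (N u) 0; first by rewrite mulr0 subr_ge0.
have Nu : 0 < N u by rewrite lt_neqAle eq_sym u0 formnorm_ge0.
have C1d12 t : t1 <= t <= t2 -> C1_at X d t.
  by move=> /andP[? ?]; apply: C1d; rewrite (le_trans at1)//= (le_trans _ t2b).
have dcd t : t1 <= t <= t2 -> derivable (c \o d : R -> E) t 1.
  move=> t12'; have [cdt _] := db _ t12'.
  by have [] := nbhs_singleton (C1_at_near (C1d12 _ t12') ac cdt).
pose L := blin_fun (g0 u) \o (c \o d) : R -> R^o.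
pose f t : R := l * L t - N u * S t.
have dL t : t1 <= t <= t2 ->
    is_derive t 1 L (g0 u (derive1 (c \o d : R -> E) t)).
  move=> /dcd /(derive1_blin_comp (g0 u)) [dL dLE].
  by apply: DeriveDef; rewrite -?derive1E.
have df t : t1 < t < t2 -> is_derive t 1 f
    (l * g0 u (derive1 (c \o d : R -> E) t) - N u * speed X d t).
  move=> /andP[t1t tt2].
  have dLt : is_derive t 1 L (g0 u (derive1 (c \o d : R -> E) t)).
    by apply: dL; rewrite !ltW.
  have dSt : is_derive t 1 S (speed X d t).
    by apply: dS; rewrite (le_lt_trans at1)//= (lt_le_trans tt2).
  exact: is_deriveB.
(* The derivative of [f] is nonpositive: by Cauchy-Schwarz, [g0 u v] is at most [N u * N v], and
   [l * N v] is at most the speed. *)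
have : f t2 <= f t1.
  apply: (@ler0_derive1_nincr _ f t1 t2) => //.
  - by move=> x; rewrite in_itv => /df [].
  - move=> x; rewrite in_itv /= => xt; rewrite derive1E.
    have [_ ->] := df _ xt.
    have x12 : t1 <= x <= t2 by case/andP: xt => ? ?; rewrite !ltW.
    rewrite subr_le0.
    apply: (@le_trans _ _ (l * (N u * N (derive1 (c \o d : R -> E) x)))).
      by apply: (ler_wpM2l (ltW l_gt0)); exact: ler_form_formnorm.
    rewrite mulrCA ler_wpM2l ?formnorm_ge0//.
    by apply: speed_ge; [exact: C1d12|exact: db].
  - have cS12 : {within `[t1, t2], continuous S}.
      apply: continuous_subspaceW cS => t /=; rewrite !in_itv/= => /andP[? ?].
      by rewrite (le_trans at1)//= (le_trans _ t2b).
    have cL : {within `[t1, t2], continuous L}.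
      apply: derivable_within_continuous => t; rewrite in_itv/= => t12'.
      by have [] := dL _ t12'.
    move=> x; apply: cvgB.
      by apply: cvgM; [exact: cvg_cst|exact: cL].
    by apply: cvgM; [exact: cvg_cst|exact: cS12].
rewrite /f -subr_ge0.
have -> : l * L t1 - N u * S t1 - (l * L t2 - N u * S t2) =
    N u * (S t2 - S t1) - l * (L t2 - L t1) by ring.
have -> : L t2 - L t1 = g0 u u :> R by rewrite [in RHS]/u formBr.
rewrite -sqr_formnorm// expr2 mulrCA -mulrBr pmulr_rge0// subr_ge0.
by [].
Qed.

Lemma formnorm_center_le t : a <= t <= b ->
  (forall t', a <= t' <= t -> chart_ball (d t')) ->
  l * N (c (d t) - x0) <= l * N (c (d a) - x0) + (S t - S a).
Proof.
move=> /andP[a_t tb] db.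
have H : l * N (c (d t) - c (d a)) <= S t - S a by exact: formnorm_le_primitive.
have -> : c (d t) - x0 = (c (d a) - x0) + (c (d t) - c (d a)).
  by rewrite [RHS]addrC addrA subrK.
rewrite (le_trans (ler_wpM2l (ltW l_gt0) (ler_formnormD _ _ ip0)))//.
by rewrite mulrDr lerD2l.
Qed.

(* The coordinates of [d] have a limit at [t] because their oscillation is
   controlled by that of [S]; since M is Hausdorff, this limit is [d t]. *)
Lemma chart_ball_closed t : a < t <= b ->
  l * N (c (d a) - x0) + (S b - S a) < l * r ->
  (forall t', a <= t' < t -> chart_ball (d t')) -> chart_ball (d t).
Proof.
move=> /andP[a_t tb] Sr db.
have St : S u @[u --> t^'-] --> S t.
  have : {within `[a, t], continuous S}.
    apply: continuous_subspaceW cS => u /=; rewrite !in_itv/= => /andP[-> ut].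
    exact: le_trans tb.
  by move=> /(continuous_within_itvP _ a_t)[].
(* The oscillation is measured in the norm of [E], at the cost of the factor [k], to be able to use
   completeness of [E]. *)
have ball_le t1 t2 : a <= t1 < t -> a <= t2 < t ->
    l * k * `|c (d t1) - c (d t2)| <= `|S t1 - S t2|.
  wlog t12 : t1 t2 / t2 <= t1.
    move=> H; have [t12|t12] := leP t2 t1; first exact: H.
    by move=> t1' t2'; rewrite distrC (distrC (S t1)); apply: H => //; exact: ltW.
  move=> /andP[at1 t1t] /andP[at2 t2t].
  apply: (le_trans _ (ler_norm _)); rewrite -mulrA.
  apply: (@le_trans _ _ (l * N (c (d t1) - c (d t2)))).
    by apply: (ler_wpM2l (ltW l_gt0)); apply: formnorm_ge => //; exact: ltW.
  apply: formnorm_le_primitive => //.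
    by rewrite (le_trans (ltW t1t)).
  move=> u /andP[t2u ut1]; apply: db.
  by rewrite (le_trans at2)//= (le_lt_trans ut1).
have : cauchy (c (d u) @[u --> t^'-]).
  apply: cauchy_exP => e e0; have lke : 0 < l * k * e / 2 by rewrite !mulr_gt0.
  have nearS : \forall u \near t^'-, a < u < t /\ `|S t - S u| < l * k * e / 2.
    near=> u; split; last by near: u; by move/cvgr_dist_lt : St; apply.
    apply/andP; split; near: u; [exact: nbhs_left_gt|exact: nbhs_left_lt].
  have [u0 [/andP[au0 u0t] Su0]] := filter_ex nearS.
  exists (c (d u0)); rewrite nbhs_simpl/=; near=> u.
  have [/andP[au ut] Su] : a < u < t /\ `|S t - S u| < l * k * e / 2 by near: u.
  rewrite -ball_normE/= -(ltr_pM2l (mulr_gt0 l_gt0 k_gt0)).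
  apply: le_lt_trans (ball_le _ _ _ _) _; rewrite ?(ltW au0) ?(ltW au)//.
  have -> : S u0 - S u = (S t - S u) - (S t - S u0) by ring.
  rewrite (le_lt_trans (ler_normB _ _))// (splitr (l * k * e)).
  exact: ltrD.
move=> /cauchy_cvg /cvg_ex [y cy].
(* The limit stays strictly inside the ball: arc length up to [u < t] is at most [S b - S a], and
   the bound on this total is strict. *)
have Ny : N (y - x0) < r.
  rewrite -(ltr_pM2l l_gt0); apply: le_lt_trans Sr.
  have cN : l * N (c (d u) - x0) @[u --> t^'-] --> l * N (y - x0).
    apply: cvgM; first exact: cvg_cst.
    by apply: formnorm_cvg; apply: cvgB => //; exact: cvg_cst.
  apply: (cvgr_to_le cN).
  near=> u; have au : a < u by near: u; exact: nbhs_left_gt.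
  have ut : u < t by near: u; exact: nbhs_left_lt.
  have ub : u <= b by rewrite (le_trans (ltW ut)).
  apply: (@le_trans _ _ (l * N (c (d a) - x0) + (S u - S a))).
    apply: formnorm_center_le; first by rewrite (ltW au).
    by move=> v /andP[av vu]; apply: db; rewrite av (le_lt_trans vu).
  by rewrite lerD2l lerD2r primitive_nondecreasing// ltW.
have [cy' yE] := chart_invP (ball_img Ny).
suff -> : d t = chart_inv c y by split => //; rewrite yE.
have ctd : {for t, continuous d} by apply: (C1d _).1; rewrite tb ltW.
have H1 : d u @[u --> t^'-] --> d t by exact: cvg_at_left_filter.
have H2 : d u @[u --> t^'-] --> chart_inv c y.
  have dE : {near t^'-, (fun u => chart_inv c (c (d u))) =1 d}.
    near=> u; rewrite chart_funK// inE; apply: (db _ _).1.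
    by apply/andP; split; near: u; [exact: nbhs_left_ge|exact: nbhs_left_lt].
  apply: cvg_trans; first exact: (near_eq_cvg dE).
  exact: (cvg_comp _ _ cy (chart_inv_cvg (ball_img Ny))).
exact: (cvg_unique (manifold_hausdorff X) H1 H2).
Unshelve. all: by end_near. Qed.

(** At the infimum [t] of the times spent outside the ball, the curve is in the ball by
    [chart_ball_closed]; openness then keeps it there a little longer, against the definition of the
    infimum. *)
Lemma chart_ball_stays : chart_dom c (d a) ->
  l * N (c (d a) - x0) + (S b - S a) < l * r ->
  forall t, a <= t <= b -> chart_ball (d t).
Proof.
move=> cda Sr.
apply: contrapT => /existsNP[t0 /not_implyP[/andP[at0 t0b] nt0]].
have ab : a <= b := le_trans at0 t0b.
have da : chart_ball (d a).
  split=> //; rewrite -(ltr_pM2l l_gt0); apply: le_lt_trans Sr.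
  by rewrite lerDl subr_ge0 primitive_nondecreasing.
pose A := [set t | a <= t <= b /\ ~ chart_ball (d t)].
have At0 : A t0 by split => //; rewrite at0.
have lA : lbound A a by move=> t [/andP[]].
have iA : has_inf A by split; [exists t0|exists a].
set t := inf A.
have a_t : a <= t by apply: lb_le_inf => //; exists t0.
have tb : t <= b by apply: le_trans t0b; apply: ge_inf => //; exists a.
have db t' : a <= t' < t -> chart_ball (d t').
  move=> /andP[at' t't]; apply: contrapT => nt'.
  have : t <= t' by apply: ge_inf; [exists a|split => //; rewrite at' (le_trans (ltW t't))].
  by rewrite leNgt t't.
have dt : chart_ball (d t).
  move: a_t; rewrite le_eqVlt => /predU1P[<-//|a_t].
  by apply: chart_ball_closed => //; rewrite a_t.
have ctd : {for t, continuous d} by apply: (C1d _).1; rewrite a_t.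
have /nbhs_ballP[e /= e0 tde] := ctd _ (near_chart_ball dt).
have [u [/andP[au ub] nu] ute] := inf_adherent e0 iA.
have tu : t <= u by apply: ge_inf; [exists a|split => //; rewrite au].
apply: nu; apply: tde; rewrite -ball_normE/=.
by rewrite distrC ger0_norm ?subr_ge0// ltrBlDl.
Qed.

End Curve.
Local Notation mu := (@lebesgue_measure R).

(** A piece of curve agrees with its C^1 extension only on the closed interval, so two-sided
    derivatives can be compared only at interior points. *)
Lemma speed_open_eq (g d : R -> M) a b t : {in `]a, b[%R, d =1 g} ->
  a < t < b -> speed X g t = speed X d t.
Proof.
move=> dg atb; have gd : {near t, g =1 d}.
  near=> u; apply/esym/dg; near: u.
  by apply: near_in_itvoo; rewrite in_itv.
rewrite /speed; have gdt := nbhs_singleton gd; rewrite gdt !derive1E.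
rewrite (@near_eq_derive _ _ _ _ (chart_at X (d t) \o d))//.
by near=> u => /=; rewrite (near gd u).
Unshelve. all: by end_near. Qed.

(** Everything is done on the C^1 extension [d], whose speed is continuous; its integral equals that
    of the speed of [g] because the end points, where the latter may be junk, are negligible. *)
Lemma C1_on_length (g : R -> M) a b : a < b -> C1_on X a b g ->
  measurable_fun `[a, b] (speed X g) /\
  exists2 ell, (\int[mu]_(t in `[a, b]) (speed X g t)%:E)%E = ell%:E &
    (chart_dom c (g a) -> l * N (c (g a) - x0) + ell < l * r ->
      chart_ball (g b) /\ l * N (c (g b) - x0) <= l * N (c (g a) - x0) + ell).
Proof.
move=> ab [d dP].
have C1d t : a <= t <= b -> C1_at X d t by move=> /dP[].
have dg t : a <= t <= b -> d t = g t by move=> /dP[].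
have dg' : {in `]a, b[%R, d =1 g}.
  by move=> t; rewrite in_itv/= => /andP[at_ tb]; rewrite dg// !ltW.
have cs : {within `[a, b], continuous (speed X d)}.
  by apply: continuous_in_subspaceT => t; rewrite inE/= in_itv/= => /C1d/speed_cvg.
have int_s : mu.-integrable `[a, b] (EFin \o speed X d).
  by apply: continuous_compact_integrable => //; exact: segment_compact.
have ms : measurable_fun `[a, b] (speed X d).
  exact: subspace_continuous_measurable_fun.
have gs t : t \in `]a, b[%R -> speed X g t = speed X d t.
  by rewrite in_itv; exact: speed_open_eq.
have oc : `]a, b[ `<=` `[a, b]%classic.
  by move=> t; rewrite /= !in_itv/= => /andP[? ?]; rewrite !ltW.
have ms' : measurable_fun `]a, b[ (speed X d) by exact: measurable_funS ms.
have mg' : measurable_fun `]a, b[ (speed X g).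
  by apply: eq_measurable_fun ms' => t; rewrite inE => /gs.
split; first exact: measurable_fun_itv_cc mg'.
pose S x := (\int[mu]_(t in `[a, x]) (speed X d t))%R.
exists (S b).
  rewrite (eq_integral_itv_bounded _ _ mg' ms')//.
  by rewrite /S /Rintegral fineK// integrable_fin_num.
have Sa : S a = 0 by rewrite /S set_itv1 Rintegral_set1.
have cS : {within `[a, b], continuous S}.
  exact: parameterized_integral_continuous (ltW ab) int_s.
have dS t : a < t < b -> is_derive t 1 S (speed X d t).
  move=> /andP[at_ tb].
  have st : {for t, continuous (speed X d)} by apply/speed_cvg/C1d; rewrite !ltW.
  have [dSt dSE] := continuous_FTC1_closed tb int_s at_ st.
  by split; [exact: dSt|rewrite -derive1E dSE].
have aab : a <= a <= b by rewrite lexx ltW.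
have abb : a <= b <= b by rewrite lexx ltW.
rewrite -!dg// -[S b]subr0 -Sa => cda Sr.
have stays := chart_ball_stays C1d dS cS cda Sr.
by split; [exact: stays|exact: (formnorm_center_le C1d dS cS)].
Qed.

(** Induction on the break points. Keeping the initial norm in the bound makes the estimates of
    successive pieces telescope: the radius already reached at one break point is the initial norm
    for the next piece. *)
Lemma path_length (g : R -> M) s a :
  path <%R a s ->
  (forall i, (i < size s)%N -> C1_on X (nth 0 (a :: s) i) (nth 0 s i) g) ->
  let b := last a s in
  measurable_fun `[a, b] (speed X g) /\
  (chart_ball (g a) ->
   ((l * N (c (g a) - x0))%:E + \int[mu]_(t in `[a, b]) (speed X g t)%:E <
     (l * r)%:E)%E ->
   chart_ball (g b) /\
   ((l * N (c (g b) - x0))%:E <=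
    (l * N (c (g a) - x0))%:E + \int[mu]_(t in `[a, b]) (speed X g t)%:E)%E).
Proof.
elim: s a => [|b s IH] a /=.
  move=> _ _; rewrite set_itv1; split; first exact: measurable_fun_set1.
  by move=> ga _; rewrite integral_set1 adde0.
move=> /andP[ab bs] C1g.
have [mb lb] := IH b bs (fun i => C1g i.+1).
have [ma [ell ellE la]] := C1_on_length ab (C1g 0%N isT).
have b_e : b <= last b s.
  elim: s b bs {IH C1g mb lb ma ellE la ab} => //= x s IH b.
  by move=> /andP[/ltW bx /IH]; exact: le_trans.
set e := last b s in mb lb b_e *.
(* The second piece is half-open to make the union disjoint; adding back the point [b] does not
   change its integral. *)
have abe : `[a, e]%classic = `[a, b] `|` `]b, e].
  rewrite -itv_bndbnd_setU//= ?bnd_simp//; exact: ltW.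
have mbe : measurable_fun `]b, e] (speed X g).
  apply: measurable_funS mb => // t; rewrite /= !in_itv/= => /andP[? ->].
  by rewrite ltW.
have me : measurable_fun `[a, e] (speed X g) by rewrite abe measurable_funU.
split => //.
have -> : (\int[mu]_(t in `[a, e]) (speed X g t)%:E =
    ell%:E + \int[mu]_(t in `[b, e]) (speed X g t)%:E)%E.
  rewrite abe ge0_integral_setU//=.
  - rewrite -ellE; congr (_ + _)%E.
    by rewrite integral_itv_obnd_cbnd//; exact/measurable_EFinP.
  - by rewrite -abe; exact/measurable_EFinP.
  - by move=> t _; rewrite lee_fin sqrtr_ge0.
  - apply/disj_setPS => t [] /=; rewrite !in_itv/= => /andP[_ tb].
    by move=> /andP[]; rewrite ltNge tb.
set I := (\int[mu]_(t in _) _)%E.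
have I0 : (0 <= I)%E by apply: integral_ge0 => t _; rewrite lee_fin sqrtr_ge0.
move=> ga; rewrite addeA -EFinD => Ir.
have [gb gbE] : chart_ball (g b) /\
    l * N (c (g b) - x0) <= l * N (c (g a) - x0) + ell.
  apply: la; first by case: ga.
  by rewrite -lte_fin; apply: le_lt_trans Ir; rewrite leeDl.
have gbI : ((l * N (c (g b) - x0))%:E + I <=
    (l * N (c (g a) - x0) + ell)%:E + I)%E by rewrite leeD2r.
have [ge geE] := lb gb (le_lt_trans gbI Ir).
by split => //; exact: le_trans gbI.
Qed.

End ChartBall.

(** * Straight lines in a chart *)

Section Segments.
Context {R : realType} {E : completeNormedModType R} {M : topologicalType}.
Variables (X : riemannian_manifold E M) (c : chart E M) (ac : atlas X c).
Implicit Types y v : E.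

Lemma is_diff_line y v (t : R) :
  is_diff t (fun s : R => y + s *: v) ( *:%R ^~ v).
Proof.
have -> : (fun s : R => y + s *: v) = cst y + ( *:%R ^~ v) by [].
apply: (is_diff_eq (is_diffD (is_diff_cst y t) (is_diff_scalel t v))).
by rewrite add0r.
Qed.

Lemma line_cvg y v (t : R) : y + s *: v @[s --> t] --> y + t *: v.
Proof.
have [d _] := is_diff_line y v t.
exact: (differentiable_continuous d).
Qed.

Lemma diff_line_comp (F : normedModType R) (f : E -> F) (f' : E -> F) y v (t : R) :
  is_diff (y + t *: v) f f' ->
  is_derive t 1 (fun s : R => f (y + s *: v)) (f' v).
Proof.
move=> df; have [d1 d1E] := is_diff_comp (is_diff_line y v t) df.
split; first exact: diff_derivable.
by rewrite deriveE// d1E/= scale1r.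
Qed.

Definition chart_line y v (t : R) : M := chart_inv c (y + t *: v).

(** Read in another chart, the line has derivative [f' (y + s *: v) v], with [f'] the Frechet
    derivative of the transition map; continuity of [f'] in operator norm makes it C^1. *)
Lemma chart_line_C1 y v (t : R) : (c @` chart_dom c) (y + t *: v) ->
  C1_at X (chart_line y v) t.
Proof.
move=> xt; split.
  apply: (@cvg_comp _ _ _ (fun s => y + s *: v) (chart_inv c)).
    exact: line_cvg.
  exact: chart_inv_cvg.
move=> c' ac' c't; have [f' [df' cf']] := atlas_smooth ac ac' 1.
have [ct xtE] := chart_invP xt.
have Ut : (c @` (chart_dom c `&` chart_dom c')) (y + t *: v).
  by exists (chart_inv c (y + t *: v)).
have near_U : \forall s \near t,
    (c @` (chart_dom c `&` chart_dom c')) (y + s *: v).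
  exact: (line_cvg (near_transition_dom Ut)).
have near_nearU := near_join near_U.
near=> s.
have Us : (c @` (chart_dom c `&` chart_dom c')) (y + s *: v) by near: s.
split; first by have [] := diff_line_comp (df' _ Us).
have nearUs : \forall r \near s,
  (c @` (chart_dom c `&` chart_dom c')) (y + r *: v) by near: s.
have dE r : (c @` (chart_dom c `&` chart_dom c')) (y + r *: v) ->
    f' (y + r *: v) v = derive1 (c' \o chart_line y v : R -> E) r.
  by move=> Ur; rewrite derive1E; have [_ ->] := diff_line_comp (df' _ Ur).
suff : f' (y + r *: v) v @[r --> s] --> f' (y + s *: v) v.
  rewrite (dE s Us); apply: cvg_trans.
  by apply: near_eq_cvg; near=> r; apply: dE; near: r.
apply: blin_cvg; last exact: cvg_cst.
apply: (@cvg_comp _ _ _ (fun r => y + r *: v) f'); first exact: line_cvg.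
exact: cf'.
Unshelve. all: by end_near. Qed.

Lemma speed_chart_line y v (t : R) : (c @` chart_dom c) (y + t *: v) ->
  speed X (chart_line y v) t = Num.sqrt (gram X c (y + t *: v) v v).
Proof.
move=> xt; have C1 := chart_line_C1 xt.
have [ct xtE] := chart_invP xt.
have cE : {near t, (fun s => y + s *: v) =1 c \o chart_line y v}.
  have img : \forall s \near t, (c @` chart_dom c) (y + s *: v).
    apply: line_cvg; apply: open_nbhs_nbhs; split => //.
    exact: chart_img_open.
  near=> s; have /chart_invP[_ sE] : (c @` chart_dom c) (y + s *: v) by near: s.
  by rewrite /= sE.
have dline : is_derive t 1 (c \o chart_line y v : R -> E) v.
  apply: (near_eq_is_derive cE).
  exact: (@diff_line_comp E id id y v t (is_diff_id _)).
have [dl dlE] := dline.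
rewrite (speedE ac C1.1 ct dl) derive1E dlE.
by rewrite xtE.
Unshelve. all: by end_near. Qed.

Lemma riemannian_distance_le_line y v (m : R) :
  (forall t, 0 <= t <= 1 -> (c @` chart_dom c) (y + t *: v)) ->
  (forall t, 0 <= t <= 1 -> Num.sqrt (gram X c (y + t *: v) v v) <= m) ->
  (riemannian_distance X (chart_inv c y) (chart_inv c (y + v)%R) <= m%:E)%E.
Proof.
move=> yv gm; apply: (@le_trans _ _ (curve_length X (chart_line y v))).
  apply: ereal_inf_lbound; exists (chart_line y v) => //; split.
  - exists [:: 1]; first by apply: itv_partition1.
    move=> [|//] _ /=; exists (chart_line y v) => t t01; split => //.
    exact/chart_line_C1/yv.
  - by rewrite /chart_line scale0r addr0.
  - by rewrite /chart_line scale1r.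
rewrite /curve_length.
have -> : m%:E = (\int[lebesgue_measure]_(t in `[0%R, 1%R]) (cst m%:E) (t : R))%E.
  rewrite integral_cst//=; rewrite lebesgue_measure_itv/= lte_fin ltr01.
  by rewrite oppr0 adde0 mule1.
have cs : {within `[0, 1], continuous (speed X (chart_line y v))}.
  apply: continuous_in_subspaceT => t; rewrite inE/= in_itv/= => /yv.
  by move/chart_line_C1/speed_cvg.
apply: ge0_le_integral => //.
- by move=> t _; rewrite lee_fin sqrtr_ge0.
- by apply/measurable_EFinP; exact: subspace_continuous_measurable_fun.
- move=> t; rewrite /= in_itv/= => t01; rewrite lee_fin speed_chart_line.
  exact: gm.
  exact: yv.
Qed.

End Segments.

(** * Local comparison with an inner product space *)

Section LocalComparison.
Context {R : realType} {E : completeNormedModType R} {M : topologicalType}.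
Variable X : riemannian_manifold E M.

Lemma riemannian_distance_lower (c : chart E M) (p q : M) g k l r :
  atlas X c -> inner_product g -> 0 < k ->
  (forall u, k ^+ 2 * `|u| ^+ 2 <= g u u) -> 0 < l -> 0 < r ->
  chart_dom c p ->
  (forall x, formnorm g (x - c p) < r -> (c @` chart_dom c) x) ->
  (forall x, formnorm g (x - c p) < r ->
    forall v, l ^+ 2 * g v v <= gram X c x v v) ->
  (riemannian_distance X p q < (l * r)%:E)%E ->
  chart_ball c (c p) g r q /\
  ((l * formnorm g (c q - c p))%:E <= riemannian_distance X p q)%E.
Proof.
move=> ac ipg k0 kg l0 r0 cp ball_img ball_gram.
have pp : chart_ball c (c p) g r p by split; rewrite // subrr formnorm0.
have H (h : R -> M) : piecewise_C1 X h -> h 0 = p -> h 1 = q ->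
    (curve_length X h < (l * r)%:E)%E ->
    chart_ball c (c p) g r q /\
    ((l * formnorm g (c q - c p))%:E <= curve_length X h)%E.
  move=> [s [s01 /eqP last1] C1h] h0 h1 hlr.
  have [_] := path_length ac ipg k0 kg l0 ball_img ball_gram s01 C1h.
  by rewrite last1 h0 h1 subrr formnorm0 mulr0 add0e; apply.
move=> pqr; split.
  have /ereal_inf_lt[_ [h [C1h h0 h1] <-] hlr] := pqr.
  exact: (H h C1h h0 h1 hlr).1.
apply: le_ereal_inf_tmp => _ [h [C1h h0 h1] <-].
have [hlr|hlr] := ltP (curve_length X h) (l * r)%:E.
  exact: (H h C1h h0 h1 hlr).2.
(* A curve of length at least [l * r] is longer than some short curve [h'] with the same ends, to
   which the bound applies. *)
have /ereal_inf_lt[_ [h' [C1h' h'0 h'1] <-] h'lr] := pqr.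
apply: le_trans hlr; apply: le_trans (ltW h'lr).
exact: (H h' C1h' h'0 h'1 h'lr).2.
Qed.

Lemma formnorm_ball_convex (g : blin E (blin E R^o)) r x y z (t : R) :
  inner_product g -> formnorm g (y - x) < r -> formnorm g (z - x) < r ->
  0 <= t <= 1 -> formnorm g (y + t *: (z - y) - x) < r.
Proof.
move=> ipg yr zr /andP[t0 t1].
have -> : y + t *: (z - y) - x = (1 - t) *: (y - x) + t *: (z - x).
  have -> : y + t *: (z - y) - x = (y - x) + t *: ((z - x) - (y - x)).
    by rewrite opprB (addrA (z - x)) subrK addrAC.
  by rewrite scalerBr scalerBl scale1r addrA [RHS]addrAC.
apply: (le_lt_trans (ler_formnormD _ _ ipg)).
rewrite !formnormZ !ger0_norm ?subr_ge0//.
(* Strictness comes from the term in [t], hence the separate case [t = 0]. *)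
have [->|tn0] := eqVneq t 0; first by rewrite subr0 mul1r mul0r addr0.
have tp : 0 < t by rewrite lt_neqAle eq_sym tn0.
have : t * formnorm g (z - x) < t * r by rewrite ltr_pM2l.
have : (1 - t) * formnorm g (y - x) <= (1 - t) * r.
  by rewrite ler_wpM2l ?subr_ge0// ltW.
lra.
Qed.

(** [f] is a chart centred at [p] and [g] the metric at [p]. Continuity of the metric keeps it
    within a factor [1 - e] to [1 + e] of [g] on a small ball, and lengths are compared through
    square roots. *)
Lemma riemannian_distance_near (p : M) (e : R) : 0 < e < 1 ->
  exists (g : blin E (blin E R^o)) (f : M -> E) (r : R),
  [/\ inner_product g, 0 < r,
   forall q, (riemannian_distance X p q < r%:E)%E ->
     ((Num.sqrt (1 - e) * formnorm g (f q))%:E <= riemannian_distance X p q)%E &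
   forall q q', (riemannian_distance X p q < r%:E)%E ->
     (riemannian_distance X p q' < r%:E)%E ->
     (riemannian_distance X q q' <=
       (Num.sqrt (1 + e) * formnorm g (f q - f q')%R)%:E)%E].
Proof.
move=> /andP[e0 e1]; set c := chart_at X p.
have ac : atlas X c := chart_at_atlas X p.
have cp : chart_dom c p := chart_at_dom X p.
set g := gram X c (c p); have ipg : inner_product g by exact: gram_inner_product.
have [k2 k20 k2g] : exists2 k : R, 0 < k & forall u, k * `|u| ^+ 2 <= g u u.
  exact: ipg.2.
set k := Num.sqrt k2; have k0 : 0 < k by rewrite sqrtr_gt0.
have kE : k ^+ 2 = k2 by rewrite sqr_sqrtr// ltW.
have kg u : k ^+ 2 * `|u| ^+ 2 <= g u u by rewrite kE.
have near_p : \forall x \near c p, (c @` chart_dom c) x /\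
    `|gram X c x - g| < e * k2.
  near=> x; split.
    near: x; apply: open_nbhs_nbhs; split; [exact: chart_img_open|by exists p].
  rewrite distrC; near: x; have /cvgr_dist_lt := gram_cvg ac cp.
  by apply; rewrite mulr_gt0.
have /nbhs_ballP[d /= d0 dP] := near_p.
(* By coercivity, the [g]-ball of radius [k * d] lies in the norm ball of radius [d]. *)
pose r := k * d; have r0 : 0 < r by rewrite mulr_gt0.
have ballP x : formnorm g (x - c p) < r -> (c @` chart_dom c) x /\
    `|gram X c x - g| < e * k2.
  move=> xr; apply: dP; rewrite -ball_normE/= distrC -(ltr_pM2l k0).
  apply: le_lt_trans xr; apply: formnorm_ge => //; exact: ltW.
have gramP x v : formnorm g (x - c p) < r ->
    (1 - e) * g v v <= gram X c x v v <= (1 + e) * g v v.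
  move=> /ballP[_ xe]; apply: (form_near _ k2g); first exact: ltW.
  exact: ltW.
set l := Num.sqrt (1 - e); have l0 : 0 < l by rewrite sqrtr_gt0 subr_gt0.
have lE : l ^+ 2 = 1 - e by rewrite sqr_sqrtr// subr_ge0 ltW.
have lower q : (riemannian_distance X p q < (l * r)%:E)%E ->
    chart_ball c (c p) g r q /\
    ((l * formnorm g (c q - c p))%:E <= riemannian_distance X p q)%E.
  apply: (riemannian_distance_lower ac ipg k0 kg l0 r0 cp).
    by move=> x /ballP[].
  by move=> x xr v; rewrite lE; have /andP[] := gramP x v xr.
exists g, (fun q => c q - c p), (l * r); split => //.
- by rewrite mulr_gt0.
- by move=> q /lower[].
move=> q q' /lower[[cq qr] _] /lower[[cq' q'r] _].
have q'E : q' = chart_inv c (c q + (c q' - c q)).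
  by rewrite addrC subrK chart_funK// inE.
rewrite [q in X in (X <= _)%E](_ : q = chart_inv c (c q)); last first.
  by rewrite chart_funK// inE.
rewrite [q' in X in (X <= _)%E]q'E.
(* The segment from [c q] to [c q'] stays in the [g]-ball by convexity. *)
apply: (riemannian_distance_le_line ac) => t t01.
  by have /ballP[] := formnorm_ball_convex ipg qr q'r t01.
have -> : c q - c p - (c q' - c p) = - 1 *: (c q' - c q).
  by rewrite scaleN1r !opprB addrA subrK.
rewrite formnormZ normrN1 mul1r /formnorm -sqrtrM; last by rewrite addr_ge0 ?ltW.
rewrite ler_wsqrtr//.
by have /andP[] := gramP _ (c q' - c q) (formnorm_ball_convex ipg qr q'r t01).
Unshelve. all: by end_near. Qed.

End LocalComparison.

(** * Tripods in the hyperbolic plane *)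

Section HyperbolicPlane.
Context {R : realType}.
Implicit Types o p q : hplane (R := R).

Lemma arcosh_le (x y : R) : 1 <= x -> 2 * x <= y -> arcosh x <= ln y.
Proof.
move=> x1 xy; have s0 := sqrtr_ge0 (x ^+ 2 - 1).
have sx : Num.sqrt (x ^+ 2 - 1) <= x.
  rewrite -[leRHS]ger0_norm; last by lra.
  by rewrite -sqrtr_sqr ler_wsqrtr// gerBl.
by rewrite /arcosh ler_ln ?posrE; lra.
Qed.

Lemma arcosh_ge (x y : R) : 0 < y -> y <= x -> ln y <= arcosh x.
Proof.
move=> y0 yx; have s0 := sqrtr_ge0 (x ^+ 2 - 1).
by rewrite /arcosh ler_ln ?posrE; lra.
Qed.

Lemma hdist_ge0 p q : 0 <= hdist p q.
Proof.
rewrite -(@ln1 R); apply: arcosh_ge => //; rewrite lerDl.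
by rewrite divr_ge0// ?addr_ge0 ?sqr_ge0// !mulr_ge0// ltW// hpt_gt0.
Qed.

Lemma hdistxx p : hdist p p = 0.
Proof.
rewrite /hdist /arcosh !subrr expr0n/= addr0 mul0r addr0 expr1n subrr.
by rewrite sqrtr0 addr0 ln1.
Qed.

(** The image of [x + i y] under the isometry [z |-> o.1 + o.2 * z] of the half-plane, which maps
    [i] to [o]. *)
Definition htranslate o (x : R) (y : {posnum R}) : hplane (R := R) :=
  @HPlane R (o.1 + o.2 * x, o.2 * y%:num) (mulr_gt0 (hpt_gt0 o) (gt0 y)).

Lemma hdist_htranslate o x y x' y' :
  hdist (htranslate o x y) (htranslate o x' y') =
  arcosh (1 + ((x - x') ^+ 2 + (y%:num - y'%:num) ^+ 2) / (2 * y%:num * y'%:num)).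
Proof.
have := hpt_gt0 o; rewrite /hdist/= => o0; congr (arcosh (1 + _)).
field; rewrite !gt_eqF//.
Qed.

Lemma hpt_inj : injective (@hpt R).
Proof.
move=> [p p0] [q q0] /= pq; case: _ / pq q0 => q0.
by congr HPlane; exact: bool_irrelevance.
Qed.

Lemma htranslate_id o : htranslate o 0 1%:pos = o.
Proof. by apply: hpt_inj; rewrite /= mulr0 addr0 mulr1; case: (hpt o). Qed.

(* Three geodesics leaving [o] in different directions: for large [T] the three
   sides of the triangle are almost twice as long as the three legs. *)
Lemma hplane_tripod o : exists (L : R) (q0 q1 q2 : hplane (R := R)),
  [/\ 0 < L,
    [/\ hdist o q0 <= 102 * L, hdist o q1 <= 102 * L & hdist o q2 <= 102 * L] &
    [/\ 199 * L <= hdist q0 q1, 199 * L <= hdist q1 q2 &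
        199 * L <= hdist q2 q0]].
Proof.
(* With [T = 2 ^+ 100], both [4 * T = 2 ^+ 102] and [T ^+ 2 / 2 = 2 ^+ 199] are powers of 2, so the
   bounds on legs and sides are integer multiples of [L = ln 2]. *)
have [T T2 [lnT lnT2]] : exists2 T : R, 2 <= T &
    ln (4 * T) = 102 * ln 2 /\ ln (T ^+ 2 / 2) = 199 * ln 2.
  exists (2 ^+ 100); first by rewrite exprS ler_pMr// exprn_ege1// ler1n.
  have -> : 4 = 2 ^+ 2 :> R by rewrite expr2 -natrM.
  rewrite -exprD -exprM lnXn// mulr_natl; split => //.
  by rewrite (exprS _ 199) mulrC mulKf// lnXn// mulr_natl.
have T0 : 0 < T by lra.
have U0 : 0 < T^-1 by rewrite invr_gt0.
pose y := PosNum T0; pose y' := PosNum U0.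
have U1 : T^-1 <= 1 by rewrite invf_le1//; lra.
(* Up to the isometry, the ends are [i T] and [i / T + 1], [i / T - 1], seen from [i]. *)
exists (ln 2), (htranslate o 0 y), (htranslate o 1 y'), (htranslate o (- 1) y').
have sq : 0 <= T^-1 ^+ 2 by rewrite sqr_ge0.
have T2sq : 0 <= T ^+ 2 by rewrite sqr_ge0.
have Tn0 : T != 0 by rewrite gt_eqF.
rewrite -lnT -lnT2; split; first by rewrite ln_gt0// ltr1n.
  rewrite -{1 3 5}(htranslate_id o) !hdist_htranslate/=; split.
  - have -> : 1 + ((0 - 0) ^+ 2 + (1 - T) ^+ 2) / (2 * 1 * T) =
      (T + T^-1) / 2 by field.
    by apply: arcosh_le; lra.
  - have -> : 1 + ((0 - 1) ^+ 2 + (1 - T^-1) ^+ 2) / (2 * 1 * T^-1) =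
      T + T^-1 / 2 by field.
    by apply: arcosh_le; lra.
  - have -> : 1 + ((0 - (- 1)) ^+ 2 + (1 - T^-1) ^+ 2) / (2 * 1 * T^-1) =
      T + T^-1 / 2 by field.
    by apply: arcosh_le; lra.
have T2p : 0 < T ^+ 2 / 2 by rewrite divr_gt0// exprn_gt0.
rewrite !hdist_htranslate/=; split; apply: arcosh_ge => //.
- have -> : 1 + ((0 - 1) ^+ 2 + (T - T^-1) ^+ 2) / (2 * T * T^-1) =
    (T ^+ 2 + 1 + T^-1 ^+ 2) / 2 by field.
  by lra.
- have -> : 1 + ((1 - (- 1)) ^+ 2 + (T^-1 - T^-1) ^+ 2) / (2 * T^-1 * T^-1) =
    1 + 2 * T ^+ 2 by field.
  by lra.
- have -> : 1 + ((- 1 - 0) ^+ 2 + (T^-1 - T) ^+ 2) / (2 * T^-1 * T) =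
    (T ^+ 2 + 1 + T^-1 ^+ 2) / 2 by field.
  by lra.
Qed.

(** * Measurability of the hyperbolic distance and of step functions *)

Local Notation mu := (@lebesgue_measure R).
Local Notation I := (`[0%R, 1%R]%classic : set (measurableTypeR R)).
Local Notation RR := (measurableTypeR R * measurableTypeR R)%type.

Lemma measurable_hdist (x y : R -> hplane (R := R)) :
  measurable_fun I (hpt \o x : measurableTypeR R -> RR) ->
  measurable_fun I (hpt \o y : measurableTypeR R -> RR) ->
  measurable_fun I (fun t => hdist (x t) (y t)).
Proof.
move=> mx my.
have m1 (z : R -> hplane (R := R)) :
    measurable_fun I (hpt \o z : measurableTypeR R -> RR) ->
    measurable_fun I (fun t => (z t).1).
  by move=> mz; exact: (measurableT_comp measurable_fst mz).
have m2 (z : R -> hplane (R := R)) :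
    measurable_fun I (hpt \o z : measurableTypeR R -> RR) ->
    measurable_fun I (fun t => (z t).2).
  by move=> mz; exact: (measurableT_comp measurable_snd mz).
(* The inverse is written as a real power, a measurable function; the two agree because the
   denominator is positive. *)
pose a t := 1 + (((x t).1 - (y t).1) ^+ 2 + ((x t).2 - (y t).2) ^+ 2) *
  (2 * (x t).2 * (y t).2) `^ (-1).
have ma : measurable_fun I a.
  apply: measurable_funD; first exact: measurable_cst.
  apply: measurable_funM.
    by apply: measurable_funD; apply: measurable_funX; apply: measurable_funB;
      [exact: m1|exact: m1|exact: m2|exact: m2].
  apply: (measurableT_comp (measurable_powR (- 1))).
  apply: measurable_funM; last exact: m2.
  by apply: measurable_funM; [exact: measurable_cst|exact: m2].
have -> : (fun t => hdist (x t) (y t)) =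
    (fun t => ln (a t + Num.sqrt (a t ^+ 2 - 1))).
  apply/funext => t; rewrite /hdist /arcosh /a powR_inv1//.
  by rewrite !mulr_ge0// ltW// hpt_gt0.
apply: (measurableT_comp (@measurable_ln R)); apply: measurable_funD => //.
apply: (measurableT_comp (continuous_measurable_fun (@sqrt_continuous R))).
by apply: measurable_funB; [exact: measurable_funX|exact: measurable_cst].
Qed.

Definition step_fun o e q (t : R) : hplane (R := R) := if t < e then q else o.

Lemma step_fun_measurable o e q :
  measurable_fun I (hpt \o step_fun o e q : measurableTypeR R -> RR).
Proof.
have -> : hpt \o step_fun o e q = (fun t => if t < e then hpt q else hpt o).
  by apply/funext => t /=; rewrite /step_fun; case: ifP.
apply: (@measurable_funS _ _ _ _ setT) => //.
apply: measurable_fun_ifT; [|exact: measurable_cst|exact: measurable_cst].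
by apply: measurable_fun_ltr; [exact: measurable_id|exact: measurable_cst].
Qed.

Lemma hdist_step_fun o e q q' t :
  hdist (step_fun o e q t) (step_fun o e q' t) =
  hdist q q' * \1_[set u : R | u < e] t.
Proof.
rewrite /step_fun indicE; case: ifPn => te.
  by rewrite mem_set// mulr1.
by rewrite memNset ?mulr0 ?hdistxx//; exact/negP.
Qed.

End HyperbolicPlane.

(** * Step maps *)

Section StepMaps.
Context {R : realType} (o : hplane (R := R)).
Implicit Types q : hplane (R := R).

Local Notation mu := (@lebesgue_measure R).
Local Notation I := (`[0%R, 1%R]%classic : set (measurableTypeR R)).

Lemma step_fun_integrable e q :
  mu.-integrable I (fun t => (hdist o (step_fun o e q t) ^+ 2)%:E).
Proof.
apply: measurable_bounded_integrable => //=.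
- by rewrite lebesgue_measure_itv/= lte_fin ltr01 oppr0 adde0 ltry.
- apply: measurable_funX; apply: measurable_hdist.
    exact: measurable_cst.
  exact: step_fun_measurable.
- exists (hdist o q ^+ 2); split; first exact: num_real.
  move=> m /ltW qm t _ /=; rewrite ger0_norm ?sqr_ge0//; apply: le_trans qm.
  by rewrite /step_fun; case: ifP => //; rewrite hdistxx expr0n/= sqr_ge0.
Qed.

Definition step_map e q : L2fun o :=
  @L2Fun R o (step_fun o e q) (step_fun_measurable o e q)
    (step_fun_integrable e q).

Definition step_class e q : L2space o := \pi_(L2space o)%qT (step_map e q).

(** Thanks to this, the centre of the ball can be fixed before the scale is chosen. *)
Lemma step_class_center e e' : step_class e o = step_class e' o.
Proof.
by apply/eqquotP/asboolP/aeW => t _; rewrite /= /step_fun !if_same.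
Qed.

Lemma repr_piP (x : L2fun o) :
  {ae mu, forall t, I t -> repr (\pi_(L2space o)%qT x) t = x t}.
Proof. by have /eqquotP/asboolP := reprK (\pi_(L2space o)%qT x). Qed.

(** [L2dist] integrates over chosen representatives; these agree almost everywhere with [x] and [y],
    so the integral is the same. *)
Lemma L2dist_pi (x y : L2fun o) :
  L2dist (\pi_(L2space o)%qT x) (\pi_(L2space o)%qT y) =
  Num.sqrt (\int[mu]_(t in I) (hdist (x t) (y t) ^+ 2)).
Proof.
have mh (u v : L2fun o) : measurable_fun I (fun t => (hdist (u t) (v t) ^+ 2)%:E).
  apply/measurable_EFinP; apply: measurable_funX; apply: measurable_hdist;
    exact: L2fun_measurable.
rewrite /L2dist /Rintegral; congr (Num.sqrt (fine _)).
apply: ae_eq_integral => //.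
apply: filterS2 (repr_piP x) (repr_piP y) => t xt yt It.
by rewrite xt// yt.
Qed.

(** The squared distance is constant on an interval of length [s ^+ 2] and zero elsewhere; the
    square root of its integral scales by [s]. This is the rescaled copy of the hyperbolic plane. *)
Lemma L2dist_step_class s q q' : 0 <= s -> s <= 1 ->
  L2dist (step_class (s ^+ 2) q) (step_class (s ^+ 2) q') = s * hdist q q'.
Proof.
move=> s0 s1; rewrite L2dist_pi.
have s21 : s ^+ 2 <= 1 by rewrite exprn_ile1.
have -> : s * hdist q q' = Num.sqrt (hdist q q' ^+ 2 * s ^+ 2).
  by rewrite -exprMn sqrtr_sqr ger0_norm ?mulr_ge0 ?hdist_ge0// mulrC.
congr Num.sqrt; rewrite /Rintegral.
have mA : measurable [set u : R | u < s ^+ 2].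
  by rewrite -set_itvNyo; exact: measurable_itv.
under eq_integral do rewrite hdist_step_fun exprMn EFinM.
rewrite ge0_integralZl_EFin//=; last 2 first.
- by apply/measurable_EFinP; apply: measurable_funX; exact: measurable_indic.
- exact: sqr_ge0.
suff -> : (\int[mu]_(t in I) (\1_[set u : R | u < s ^+ 2] t ^+ 2)%:E =
    (s ^+ 2)%:E)%E by [].
under eq_integral => t _.
  rewrite (_ : _ ^+ 2 = \1_[set u : R | u < s ^+ 2] t); last first.
    by rewrite indicE; case: (_ \in _); rewrite ?expr1n ?expr0n.
  over.
rewrite integral_indic//.
have -> : [set u : R | u < s ^+ 2] `&` I = `[0, s ^+ 2[%classic.
  apply/seteqP; split => t /=; rewrite !in_itv/=.
    by move=> [ts /andP[-> _]].
  by move=> /andP[t0 ts]; split => //; rewrite t0 (le_trans (ltW ts)).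
rewrite /= lebesgue_measure_itv/= lte_fin.
(* The second case is [s = 0], where the interval is empty. *)
case: ifPn => [_|]; first by rewrite oppr0 adde0.
by rewrite -leNgt => s20; congr EFin; apply/esym/le_anti; rewrite s20 sqr_ge0.
Qed.

End StepMaps.

(** * Small tripods against the local comparison *)

Theorem proposition4p8 (R : realType) (o : hplane (R := R))
    (E : completeNormedModType R) (hE : hilbert E)
    (M : topologicalType) (X : riemannian_manifold E M) :
  ~ exists Phi : L2space o -> M, bijective Phi /\
      forall x y : L2space o,
        riemannian_distance X (Phi x) (Phi y) = (L2dist x y)%:E.
Proof.
move=> [Phi [_ iso]].
have [L [q0 [q1 [q2 [L0 [oq0 oq1 oq2] [q01 q12 q20]]]]]] := hplane_tripod o.
have e01 : 0 < (20^-1 : R) < 1.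
  by rewrite invr_gt0 ltr0n/= invf_lt1 ?ltr0n// ltr1n.
have [g [f [r [ipg r0 lower upper]]]] :=
  riemannian_distance_near X (Phi (step_class o 0 o)) e01.
have D0 : 0 < 103 * L by rewrite mulr_gt0.
(* The bound 1 keeps the support of the steps inside the unit interval; 103 instead of 102 makes the
   scaled legs strictly shorter than [r]. *)
pose s := Num.min 1 (r / (103 * L)).
have s0 : 0 < s by rewrite lt_min ltr01 divr_gt0.
have s1 : s <= 1 by rewrite ge_min lexx.
have sr : s * (103 * L) <= r by rewrite -ler_pdivlMr// ge_min lexx orbT.
have sL0 : 0 < s * L by rewrite mulr_gt0.
pose p q := Phi (step_class o (s ^+ 2) q).
have dp q q' : riemannian_distance X (p q) (p q') = (s * hdist q q')%:E.
  by rewrite iso L2dist_step_class// ltW.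
have pE : Phi (step_class o 0 o) = p o by rewrite (step_class_center o 0 (s ^+ 2)).
rewrite pE in lower upper.
have leg q : hdist o q <= 102 * L -> s * hdist o q < r.
  move=> oq; apply: lt_le_trans sr; rewrite ltr_pM2l//.
  apply: (le_lt_trans oq); rewrite ltr_pM2r//; lra.
have bound_leg q : hdist o q <= 102 * L ->
    (1 - 20^-1) * g (f (p q)) (f (p q)) <= (102 * (s * L)) ^+ 2.
  move=> oq; have := lower (p q); rewrite dp !lte_fin lee_fin => /(_ (leg q oq)) H.
  rewrite -sqr_formnorm// -[1 - 20^-1 in leLHS]sqr_sqrtr; last lra.
  rewrite -exprMn ler_sqr ?nnegrE ?mulr_ge0 ?formnorm_ge0 ?sqrtr_ge0
    ?(ltW s0) ?(ltW L0)//.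
  by apply: (le_trans H); rewrite mulrCA ler_wpM2l// ltW.
have bound_side q q' : hdist o q <= 102 * L -> hdist o q' <= 102 * L ->
    199 * L <= hdist q q' ->
    (199 * (s * L)) ^+ 2 <=
    (1 + 20^-1) * g (f (p q) - f (p q')) (f (p q) - f (p q')).
  move=> oq oq' qq'; have := upper (p q) (p q').
  rewrite !dp !lte_fin lee_fin => /(_ (leg q oq) (leg q' oq')) H.
  rewrite -sqr_formnorm// -[1 + 20^-1 in leRHS]sqr_sqrtr; last lra.
  rewrite -exprMn ler_sqr ?nnegrE ?mulr_ge0 ?formnorm_ge0 ?sqrtr_ge0
    ?(ltW s0) ?(ltW L0)//.
  by apply: le_trans H; rewrite mulrCA ler_wpM2l// ltW.
have A0 : 0 < (s * L) ^+ 2 by rewrite exprn_gt0.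
have := inner_product_tripod (f (p q0)) (f (p q1)) (f (p q2)) ipg.
have := bound_leg _ oq0; have := bound_leg _ oq1; have := bound_leg _ oq2.
have := bound_side _ _ oq0 oq1 q01; have := bound_side _ _ oq1 oq2 q12.
have := bound_side _ _ oq2 oq0 q20.
(* After dividing by [A = (s * L) ^+ 2], the bounds would give [199^2 * (1 - 1/20) <= 3 * 102^2 * (1
   + 1/20)], whereas the left side exceeds 37000 and the right side is below 33000. *)
rewrite !(exprMn 2 _ (s * L)); move: ((s * L) ^+ 2) A0 => A A0.
lra.
Qed.
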